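(* Consider marching the system $$\frac{d\sqrt{\mathcal{J}}}{dt}=\tfrac12\big(\underline{\boldsymbol\nabla\cdot\dot{\boldsymbol X}}\big)\sqrt{\mathcal{J}},\qquad \frac{d\hat{\boldsymbol U}}{dt}=RHS\big(\sqrt{\mathcal{J}},\boldsymbol U,t\big),\qquad \hat{\boldsymbol U}=\underline{\sqrt{\mathcal{J}}}\,\boldsymbol U,$$ $$RHS\big(\sqrt{\mathcal{J}},\boldsymbol U,t\big)=\underline{\sqrt{\mathcal{J}}}\Big[\mathcal{D}_m\boldsymbol U+\mathcal{D}(\boldsymbol U,t)\boldsymbol U+\mathcal{L}_{\boldsymbol\delta}\big[\mathcal{B}(\boldsymbol U,t)\boldsymbol U-G(t)\big]+\boldsymbol F(t)\Big],$$ forward in time using a general $s$-stage explicit Runge-Kutta scheme with coefficients $a_{k\nu},b_k,c_k$ and time step $\Delta t$: $$\sqrt{\mathcal{J}^{n+1}}=\sqrt{\mathcal{J}^{n}}+\Delta t\sum_{k=1}^s\frac{b_k}{2}\big(\underline{\boldsymbol\nabla\cdot\dot{\boldsymbol X}}(t_n+c_k\Delta t)\big)\sqrt{\bar{\mathcal{J}}^k},$$ $$\underline{\sqrt{\mathcal{J}^{n+1}}}\,\boldsymbol U^{n+1}=\underline{\sqrt{\mathcal{J}^{n}}}\,\boldsymbol U^{n}+\Delta t\sum_{k=1}^s b_k\,RHS\big(\sqrt{\bar{\mathcal{J}}^k},\bar{\boldsymbol U}^k,t_n+c_k\Delta t\big),$$ where the stage values are defined, for $k=1,\dots,s$, by $$\sqrt{\bar{\mathcal{J}}^{k}}=\sqrt{\mathcal{J}^{n}}+\Delta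 t\sum_{\nu=1}^{k-1}\frac{a_{k\nu}}{2}\big(\underline{\boldsymbol\nabla\cdot\dot{\boldsymbol X}}(t_n+c_\nu\Delta t)\big)\sqrt{\bar{\mathcal{J}}^\nu},$$ $$\underline{\sqrt{\bar{\mathcal{J}}^{k}}}\,\bar{\boldsymbol U}^{k}=\underline{\sqrt{\mathcal{J}^{n}}}\,\boldsymbol U^{n}+\Delta t\sum_{\nu=1}^{k-1}a_{k\nu}\,RHS\big(\sqrt{\bar{\mathcal{J}}^\nu},\bar{\boldsymbol U}^\nu,t_n+c_\nu\Delta t\big).$$ Suppose that the same set of operators $\mathcal{D}_{x_i}$ is used in $\mathcal{D}_m=\frac12\sum_{i=1}^p(\underline{\dot{\boldsymbol X}}_i\mathcal{D}_{x_i}+\mathcal{D}_{x_i}\underline{\dot{\boldsymbol X}}_i)$ and in $\boldsymbol\nabla\cdot\dot{\boldsymbol X}=\sum_{i=1}^p\mathcal{D}_{x_i}\dot{\boldsymbol X}_i$, that $\mathcal{D}_{x_i}\mathbb{1}=0$ for $i=1,\dots,p$, and that for any real number $u_\infty$, with $\boldsymbol U_\infty=u_\infty\mathbb{1}$ and the corresponding choice of data, $\mathcal{D}(\boldsymbol U_\infty,t)\boldsymbol U_\infty=0$, $\mathcal{B}(\boldsymbol U_\infty,t)\boldsymbol U_\infty=G(t)$ and $\boldsymbol F(t)=0$. Then this time marching scheme is free-stream preserving, i.e. $\boldsymbol U^n=\boldsymbol U_\infty$ implies $\boldsymbol U^{n+1}=\boldsymbol U_\infty$.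
   Context: Notation: for a vector $\boldsymbol v$, $\underline{\boldsymbol v}=\mathrm{Diag}(\boldsymbol v)$; $\mathbb{1}\in\mathbb{R}^{n_V}$ is the vector of ones. The symbols $\sqrt{\mathcal{J}^n}$, $\sqrt{\bar{\mathcal{J}}^k}$ denote the vectors in $\mathbb{R}^{n_V}$ computed by the scheme; they are taken to have strictly positive entries (the discrete Jacobian is positive), so that $\boldsymbol U^{n+1}$ and $\bar{\boldsymbol U}^k$ are well defined. Operators and data may depend on $t$; the consistency hypotheses are required at all times, and at each stage time the same operators $\mathcal{D}_{x_i}$ and velocities $\dot{\boldsymbol X}_i$ are used in $\mathcal{D}_m$ and $\boldsymbol\nabla\cdot\dot{\boldsymbol X}$. Setting: a moving volume mesh has $n_V$ nodes, a subset of $n_S$ of which are surface nodes, with $n_S\times n_V$ restriction matrix $E$ (each row has a single nonzero entry equal to $1$). $\mathcal{P}=\underline{\mathcal{J}}\hat{\mathcal{P}}\in\mathbb{R}^{n_V}$ ($\hat{\mathcal{P}}$ constant in time, positive) and $P\in\mathbb{R}^{n_S}$ are volume and surface quadrature weights. The $n_V\times n_V$ matrices $\mathcal{D}_{x_i}$ approximate $\partial/\partial x_i$ and satisfy the summation-by-parts property $\mathcal{D}_{x_i}=\underline{\mathcal{P}}^{-1}\mathcal{Q}_{x_i}$, $\mathcal{Q}_{x_i}+\mathcal{Q}_{x_i}^T=E^T\underline{P}\,\underline{N}_iE$, with $N_i\in\mathbb{R}^{n_S}$ the surface node values of the $i$-th normal component. $\dot{\boldsymbol X}_i\in\mathbb{R}^{n_V}$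 contains nodal values of the mesh velocity component $\dot x_i$. $\mathcal{D}(\boldsymbol U,t)$ is $n_V\times n_V$, $\mathcal{B}(\boldsymbol U,t)$ is $n_S\times n_V$, and $\mathcal{L}_{\boldsymbol\delta}=\underline{\mathcal{P}}^{-1}\boldsymbol\delta^T\underline{P}$ for an $n_S\times n_V$ matrix $\boldsymbol\delta$. *)

(* Defs.v *)
From HB Require Import structures.
From mathcomp Require Import all_boot all_order all_algebra.

Set Implicit Arguments.
Unset Strict Implicit.
Unset Printing Implicit Defensive.

Import Order.TTheory GRing.Theory Num.Theory.
Local Open Scope ring_scope.

Definition Diag (R : realFieldType) (n : nat) (v : 'cV[R]_n) : 'M[R]_n :=
  diag_mx v^T.

Definition ones (R : realFieldType) (n : nat) : 'cV[R]_n := const_mx 1.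

Definition positive (R : realFieldType) (n : nat) (v : 'cV[R]_n) : Prop :=
  forall i, 0 < v i 0.

(* Spatial discretization on a moving mesh with nV nodes, nS surface nodes and
   p space dimensions. Arguments [w] and [t] stand for the vector sqrt(J) and
   the time at which an object is evaluated. Operators may depend on both,
   since P = Diag(J) Phat involves the Jacobian; purely time-dependent
   operators are the ones that ignore [w]. Accordingly [jac w t] is the
   Jacobian J entering P: the entrywise square of [w], or an exact Jacobian
   known as a function of [t]. *)
Record discretization (R : realFieldType) (nV nS p : nat) := Discretization {
  surf_node : 'I_nS -> 'I_nV;
  Phat : 'cV[R]_nV;
  jac : 'cV[R]_nV -> R -> 'cV[R]_nV;
  surf_weights : 'cV[R]_nV -> R -> 'cV[R]_nS;
  normal : 'cV[R]_nV -> R -> 'I_p -> 'cV[R]_nS;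
  Dx : 'cV[R]_nV -> R -> 'I_p -> 'M[R]_nV;
  Xdot : R -> 'I_p -> 'cV[R]_nV;
  delta : 'cV[R]_nV -> R -> 'M[R]_(nS, nV);
  (* In [Dop w U t] and [Bop w U t] the second argument is the solution. *)
  Dop : 'cV[R]_nV -> 'cV[R]_nV -> R -> 'M[R]_nV;
  Bop : 'cV[R]_nV -> 'cV[R]_nV -> R -> 'M[R]_(nS, nV)
}.

Section Discretization.
Variables (R : realFieldType) (nV nS p : nat) (d : discretization R nV nS p).
Implicit Types (w U : 'cV[R]_nV) (t u : R).

Definition restriction : 'M[R]_(nS, nV) :=
  \matrix_(i, j) (j == surf_node d i)%:R.

Definition vol_weights w t : 'cV[R]_nV := Diag (jac d w t) *m Phat d.

Definition summation_by_parts w t (i : 'I_p) : Prop :=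
  exists Q : 'M[R]_nV,
    Dx d w t i = invmx (Diag (vol_weights w t)) *m Q /\
    Q + Q^T = restriction^T *m Diag (surf_weights d w t)
              *m Diag (normal d w t i) *m restriction.

Definition sbp_discretization : Prop :=
  [/\ injective (surf_node d),
      positive (Phat d),
      forall w t, positive w -> positive (jac d w t) &
      forall w t, positive w -> forall i, summation_by_parts w t i].

Definition Dm w t : 'M[R]_nV :=
  2^-1 *: \sum_(i < p)
    (Diag (Xdot d t i) *m Dx d w t i + Dx d w t i *m Diag (Xdot d t i)).

Definition divX w t : 'cV[R]_nV := \sum_(i < p) Dx d w t i *m Xdot d t i.

Definition Lift w t : 'M[R]_(nV, nS) :=
  invmx (Diag (vol_weights w t)) *m (delta d w t)^T
  *m Diag (surf_weights d w t).

Definition rhsJ w t : 'cV[R]_nV := 2^-1 *: (Diag (divX w t) *m w).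

Definition RHS (G : R -> 'cV[R]_nS) (F : R -> 'cV[R]_nV) w U t : 'cV[R]_nV :=
  Diag w *m (Dm w t *m U + Dop d w U t *m U
             + Lift w t *m (Bop d w U t *m U - G t) + F t).

(* [G u] and [F u] are the boundary and forcing data that correspond to the
   free stream u * ones. *)
Definition free_stream_data
    (G : R -> R -> 'cV[R]_nS) (F : R -> R -> 'cV[R]_nV) : Prop :=
  forall u w t, positive w ->
    [/\ Dop d w (u *: ones R nV) t *m (u *: ones R nV) = 0,
        Bop d w (u *: ones R nV) t *m (u *: ones R nV) = G u t &
        F u t = 0].

End Discretization.

(* One step of the explicit scheme with tableau (a, b, c), from [sJ], [U] at
   time [tn] to [sJ1], [U1] at time [tn + dt]; [sJbar], [Ubar] are the stage
   values. Only the strictly lower triangular part of [a] is used. *)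
Definition rk_step (R : realFieldType) (nV nS p : nat)
    (d : discretization R nV nS p)
    (G : R -> 'cV[R]_nS) (F : R -> 'cV[R]_nV)
    (s : nat) (a : 'M[R]_s) (b c : 'I_s -> R) (tn dt : R)
    (sJ U : 'cV[R]_nV) (sJbar Ubar : 'I_s -> 'cV[R]_nV)
    (sJ1 U1 : 'cV[R]_nV) : Prop :=
  [/\ forall k, sJbar k = sJ + dt *: \sum_(nu < s | (nu < k)%N)
        a k nu *: rhsJ d (sJbar nu) (tn + c nu * dt),
      forall k, Diag (sJbar k) *m Ubar k = Diag sJ *m U
        + dt *: \sum_(nu < s | (nu < k)%N)
            a k nu *: RHS d G F (sJbar nu) (Ubar nu) (tn + c nu * dt),
      sJ1 = sJ + dt *: \sum_(k < s)
        b k *: rhsJ d (sJbar k) (tn + c k * dt) &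
      Diag sJ1 *m U1 = Diag sJ *m U
        + dt *: \sum_(k < s)
            b k *: RHS d G F (sJbar k) (Ubar k) (tn + c k * dt)].

Definition free_stream_preserving (R : realFieldType) (nV nS p : nat)
    (d : discretization R nV nS p)
    (G : R -> R -> 'cV[R]_nS) (F : R -> R -> 'cV[R]_nV)
    (s : nat) (a : 'M[R]_s) (b c : 'I_s -> R) : Prop :=
  forall (u tn dt : R) (sJ U : 'cV[R]_nV) (sJbar Ubar : 'I_s -> 'cV[R]_nV)
    (sJ1 U1 : 'cV[R]_nV),
  rk_step d (G u) (F u) a b c tn dt sJ U sJbar Ubar sJ1 U1 ->
  positive sJ -> (forall k, positive (sJbar k)) -> positive sJ1 ->
  U = u *: ones R nV -> U1 = u *: ones R nV.

(* Main.v *)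
(* On the free stream the velocity-divergence half of D_m is the only part of RHS
   that survives, so RHS equals u times the right-hand side of the sqrt(J)
   equation. Hence sqrt(J) * U obeys u times the very recursion defining sqrt(J),
   at every stage and at the final update, and dividing by sqrt(J) > 0 gives u. *)

Require Import Defs.
From HB Require Import structures.
From mathcomp Require Import all_boot all_order all_algebra.

Set Implicit Arguments.
Unset Strict Implicit.
Unset Printing Implicit Defensive.

Import Order.TTheory GRing.Theory Num.Theory.
Local Open Scope ring_scope.

Lemma Diag_mulE (R : realFieldType) (n : nat) (v x : 'cV[R]_n) i :
  (Diag v *m x) i 0 = v i 0 * x i 0.
Proof. by rewrite mul_diag_mx !mxE. Qed.

Lemma Diag_mulC (R : realFieldType) (n : nat) (v x : 'cV[R]_n) :
  Diag v *m x = Diag x *m v.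
Proof. by apply/colP => i; rewrite !Diag_mulE mulrC. Qed.

Lemma Diag_ones (R : realFieldType) (n : nat) (v : 'cV[R]_n) :
  Diag v *m ones R n = v.
Proof. by apply/colP => i; rewrite Diag_mulE mxE mulr1. Qed.

Lemma Diag_mul_eq_scale (R : realFieldType) (n : nat) (v x : 'cV[R]_n) (u : R) :
  positive v -> Diag v *m x = u *: v -> x = u *: ones R n.
Proof.
move=> v_gt0 /colP eq_vx; apply/colP => i; have := eq_vx i.
rewrite Diag_mulE !mxE mulr1 [u * _]mulrC.
by apply: mulfI; rewrite gt_eqF.
Qed.

Section FreeStream.
Variables (R : realFieldType) (nV nS p : nat) (d : discretization R nV nS p).
Variables (w : 'cV[R]_nV) (t : R).
Hypothesis Dx_ones : forall i, Dx d w t i *m ones R nV = 0.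

(** In each direction, the term with [Dx] applied first vanishes by consistency; in the other,
    [Diag (Xdot d t i)] turns [ones] into the velocity, which the same [Dx] then differentiates. *)
Lemma Dm_ones : Dm d w t *m ones R nV = 2^-1 *: divX d w t.
Proof.
rewrite -scalemxAl mulmx_suml; congr (_ *: _); apply: eq_bigr => i _.
by rewrite mulmxDl -!mulmxA Dx_ones mulmx0 add0r Diag_ones.
Qed.

Lemma RHS_free_stream (G : R -> R -> 'cV[R]_nS) (F : R -> R -> 'cV[R]_nV) u :
  positive w -> free_stream_data d G F ->
  Defs.RHS d (G u) (F u) w (u *: ones R nV) t = u *: rhsJ d w t.
Proof.
move=> w_gt0 /(_ u w t w_gt0)[D0 BG F0].
rewrite /Defs.RHS D0 BG F0 subrr mulmx0 !addr0 -scalemxAr Dm_ones -!scalemxAr.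
(* Here [Diag w] acts on the divergence, whereas in [rhsJ] the divergence acts on [w]; entrywise
   products commute. *)
by rewrite Diag_mulC.
Qed.

End FreeStream.

Theorem proposition4p2 (R : realFieldType) (nV nS p : nat)
    (d : discretization R nV nS p)
    (G : R -> R -> 'cV[R]_nS) (F : R -> R -> 'cV[R]_nV)
    (s : nat) (a : 'M[R]_s) (b c : 'I_s -> R) :
  sbp_discretization d ->
  (forall (w : 'cV[R]_nV) (t : R), positive w ->
     forall i : 'I_p, Dx d w t i *m ones R nV = 0) ->
  free_stream_data d G F ->
  free_stream_preserving d G F a b c.
Proof.
move=> _ Dx_ones fsd u tn dt sJ U sJbar Ubar sJ1 U1.
case=> sJbarE UbarE sJ1E U1E _ sJbar_gt0 sJ1_gt0 U_eq.
(* Stages and final update share this form: [P] selects the earlier stages with a row of [a] as [e],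
   or all stages with [b]. *)
have update (P : pred 'I_s) (e : 'I_s -> R) (sJ' U' : 'cV[R]_nV) :
    (forall k, P k -> Ubar k = u *: ones R nV) -> positive sJ' ->
    sJ' = sJ + dt *: \sum_(k < s | P k) e k *: rhsJ d (sJbar k) (tn + c k * dt) ->
    Diag sJ' *m U' = Diag sJ *m U + dt *: \sum_(k < s | P k)
      e k *: Defs.RHS d (G u) (F u) (sJbar k) (Ubar k) (tn + c k * dt) ->
    U' = u *: ones R nV.
  move=> Ubar_eq sJ'_gt0 sJ'E U'E; apply: (Diag_mul_eq_scale sJ'_gt0).
  rewrite U'E {}sJ'E U_eq -scalemxAr Diag_ones scalerDr; congr (_ + _).
  rewrite !scaler_sumr; apply: eq_bigr => k Pk.
  rewrite Ubar_eq // (RHS_free_stream (Dx_ones _ _ (sJbar_gt0 k))) //.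
  by rewrite !scalerA -[u * _ * _]mulrA [u * _]mulrC.
have Ubar_eq k : Ubar k = u *: ones R nV.
  (* Strong induction on the stage index: in an explicit scheme, stage [k] draws only on stages
     [nu < k]. *)
  have [m] := ubnP (k : nat); elim: m k => // m IHm k; rewrite ltnS => le_km.
  apply: (update _ _ _ _ _ (sJbar_gt0 k) (sJbarE k) (UbarE k)) => nu lt_nuk.
  exact/IHm/(leq_trans lt_nuk).
exact: (update _ _ _ _ (fun k _ => Ubar_eq k) sJ1_gt0 sJ1E U1E).
Qed.
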